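(* Let $f$ be an $n$-ary operation of a GSOS language that is quiescent consistent. Then for every vector $\vec p=(p_1,\dots,p_n)$ of states of an LTS with inputs and outputs and every $p'$: $f(\vec p)\xrightarrow{\delta!}p'$ if and only if $p'=f(\vec p)$ and $f(\vec p)$ has no $a!$-transition for any $a!\in O\setminus\{\delta!\}$.
   Context: Actions: disjoint finite sets $I$ (inputs $a?$) and $O$ (outputs $a!$, including quiescence $\delta!$), $L=I\cup O$. An LTS with inputs and outputs is $(S,I,O,\to)$ with $\to\subseteq S\times L\times S$ such that $p\xrightarrow{\delta!}p'$ iff $p=p'$ and $p$ has no $a!$-transition for $a!\in O\setminus\{\delta!\}$. A GSOS rule for $f$ has the form $\dfrac{\{x_i\xrightarrow{a_{ij}}y_{ij}\}\cup\{x_i\not\xrightarrow{b_{ik}}\}}{f(x_1,\dots,x_n)\xrightarrow{a}C}$ with all $x_i,y_{ij}$ distinct variables and $C$ a term over them; the language defines $f(\vec p)\xrightarrow{a}C[\vec p,\vec q]$ iff some $f$-rule has $p_i\xrightarrow{a_{ij}}q_{ij}$ and $p_i$ has no $b_{ik}$-transition for all $i,j,k$. Sets of transition formulae that contradict each other: $\{x\xrightarrow{a}y\}$ and $\{x\not\xrightarrow{a}\}$ ($a\in L$); $\{x\xrightarrow{b!}y\}$ and $\{x\xrightarrow{\delta!}z\}$ ($b!\in O\setminus\{\delta!\}$); nonempty $H,H'$ with $H\cup H'=\{x\not\xrightarrow{b!}\mid b!\in O\}$. Formulae $x\xrightarrow{a}y$ and $x\not\xrightarrow{a}$ negate each other.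 $H_1,H_2$ are contradictory if some $H_1'\subseteq H_1$, $H_2'\subseteq H_2$ contradict each other. $f$ is quiescent consistent if: [$\delta_1$] for every $f$-rule $H/f(\vec x)\xrightarrow{\delta!}t$: (1) for every $f$-rule $H'/f(\vec x)\xrightarrow{b!}t'$ with $b!\in O\setminus\{\delta!\}$, $H$ and $H'$ are contradictory, and (2) $t=f(\vec y)$ where for each $i$ either $y_i=x_i$ or $x_i\xrightarrow{\delta!}y_i\in H$; [$\delta_2$] letting $r_1,\dots,r_m$ be the output-emitting $f$-rules whose conclusion label is not $\delta!$, the rules for $f$ include every rule $\{l_1,\dots,l_m\}/f(\vec x)\xrightarrow{\delta!}f(\vec x)$ where each $l_i$ negates some premise of $r_i$ and no two subsets of $\{l_1,\dots,l_m\}$ contradict each other. *)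

(* Defs.v *)
From HB Require Import structures.
From mathcomp Require Import all_boot finmap.
From Stdlib Require List.

Set Implicit Arguments.
Unset Strict Implicit.
Unset Printing Implicit Defensive.

Local Open Scope fset_scope.

(* Inputs a? are [inl a] and outputs b! are [inr b]; the quiescence action is a
   distinguished element delta : O. *)
Definition action (I O : finType) : finType := (I + O)%type.

Section Actions.
Variables I O : finType.
Local Notation L := (action I O).

Definition out (b : O) : L := inr b.

Record lts := Lts {
  state :> Type;
  trans : state -> L -> state -> Prop }.

Definition enabled (M : lts) (p : M) (a : L) : Prop := exists p' : M, trans p a p'.

Definition lts_io (delta : O) (M : lts) : Prop :=
  forall p p' : M, trans p (out delta) p' <->
    p = p' /\ forall b : O, b != delta -> ~ enabled p (out b).

(* [Pos i a k] is x_i -a-> y_k and [Neg i a] is x_i -/a->, for an operation with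
   arguments x_0, ..., x_(n-1). *)
Inductive formula (n : nat) : Type :=
  | Pos of 'I_n & L & nat
  | Neg of 'I_n & L.

Definition formula_encode n (h : formula n) : ('I_n * L * nat) + ('I_n * L) :=
  match h with Pos i a k => inl (i, a, k) | Neg i a => inr (i, a) end.
Definition formula_decode n (c : ('I_n * L * nat) + ('I_n * L)) : formula n :=
  match c with inl (i, a, k) => Pos i a k | inr (i, a) => Neg i a end.
Lemma formula_encodeK n : cancel (@formula_encode n) (@formula_decode n).
Proof. by case. Qed.
HB.instance Definition _ n :=
  Countable.copy (formula n) (can_type (@formula_encodeK n)).

Section Contradiction.
Variables (delta : O) (n : nat).
Implicit Types H : {fset formula n}.

Inductive contradict : {fset formula n} -> {fset formula n} -> Prop :=
  | contradict_neg i a k :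
      contradict [fset Pos i a k] [fset Neg i a]
  | contradict_delta i b k k' : b != delta ->
      contradict [fset Pos i (out b) k] [fset Pos i (out delta) k']
  | contradict_outputs i H H' : H != fset0 -> H' != fset0 ->
      H `|` H' = [fset Neg i (out b) | b in O] ->
      contradict H H'.

Definition contradict_each_other H H' : Prop := contradict H H' \/ contradict H' H.

Definition contradictory H1 H2 : Prop :=
  exists H1' H2', [/\ H1' `<=` H1, H2' `<=` H2 & contradict_each_other H1' H2'].

End Contradiction.

Definition negates n (h h' : formula n) : Prop :=
  match h, h' with
  | Pos i a _, Neg i' a' | Neg i a, Pos i' a' _ => i = i' /\ a = a'
  | _, _ => False
  end.

Record signature := Signature { op :> Type; arity : op -> nat }.

Inductive term (Sg : signature) (V : Type) : Type :=
  | Var of V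
  | Op (f : Sg) of {ffun 'I_(arity f) -> term Sg V}.

Fixpoint subst (Sg : signature) (V W : Type) (s : V -> term Sg W) (t : term Sg V) :
    term Sg W :=
  match t with
  | Var v => s v
  | Op f ts => Op [ffun i => subst s (ts i)]
  end.

Fixpoint occurs (Sg : signature) (V : Type) (v : V) (t : term Sg V) : Prop :=
  match t with
  | Var w => v = w
  | Op f ts => exists i, occurs v (ts i)
  end.

Inductive var (n : nat) : Type := X of 'I_n | Y of nat.
Arguments Y {n}.

(* A rule  prem / f(x_0, ..., x_(n-1)) -label-> target  for an n-ary f. *)
Record rule (Sg : signature) (n : nat) := Rule {
  prem : {fset formula n};
  label : L;
  target : term Sg (var n) }.

(* Distinctness of the x_i, and of the x_i from the y_k, is built into [var]. *)
Definition gsos_rule (Sg : signature) n (r : rule Sg n) : Prop :=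
  (forall i i' a a' k, Pos i a k \in prem r -> Pos i' a' k \in prem r ->
     i = i' /\ a = a') /\
  (forall k, occurs (Y k) (target r) -> exists i a, Pos i a k \in prem r).

Definition rename_var n (rho : nat -> nat) (v : var n) : var n :=
  match v with X i => X i | Y k => Y (rho k) end.

Definition rename_formula n (rho : nat -> nat) (h : formula n) : formula n :=
  match h with Pos i a k => Pos i a (rho k) | Neg i a => Neg i a end.

Definition rename_rule (Sg : signature) n (rho : nat -> nat) (r : rule Sg n) :
    rule Sg n :=
  Rule [fset rename_formula rho h | h in prem r] (label r)
       (subst (fun v => Var Sg (rename_var rho v)) (target r)).

Record gsos_language := GsosLanguage {
  sig :> signature;
  rules : forall f : sig, rule sig (arity f) -> Prop;
  rules_gsos : forall (f : sig) (r : rule sig (arity f)), rules r -> gsos_rule r;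
  rules_finite : forall f : sig, exists s : seq (rule sig (arity f)),
    forall r, rules r -> List.In r s }.

Section Language.
Variable G : gsos_language.

(* Rules are identified up to the names of the y_k: a finite rule set cannot
   contain all the renamings of a rule. *)
Definition includes_rule (f : G) (r : rule G (arity f)) : Prop :=
  exists2 rho : nat -> nat, bijective rho & rules (rename_rule rho r).

(* The states of M are the constants ([Var]) from which terms are built. *)
Fixpoint step (M : lts) (t : term G M) : L -> term G M -> Prop :=
  match t with
  | Var p => fun a t' => exists2 p', trans p a p' & t' = Var G p'
  | Op f ts => fun a t' =>
      exists (r : rule G (arity f)) (q : nat -> term G M),
        [/\ rules r /\ label r = a,
            forall i b k, Pos i b k \in prem r -> step (ts i) b (q k),
            forall i b, Neg i b \in prem r -> ~ exists u, step (ts i) b u &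
            t' = subst (fun v => match v with X i => ts i | Y k => q k end)
                       (target r)]
  end.

Definition gsos_lts (M : lts) : lts := @Lts (term G M) (@step M).

Section QuiescentConsistent.
Variables (delta : O) (f : G).
Let n := arity f.
Implicit Types r : rule G n.

Definition output_rule r : Prop :=
  rules r /\ exists2 b : O, b != delta & label r = out b.

Definition delta1 : Prop :=
  forall r, rules r -> label r = out delta ->
    (forall r', output_rule r' -> contradictory delta (prem r) (prem r')) /\
    exists2 y : {ffun 'I_n -> var n},
      target r = Op [ffun i => Var G (y i)] &
      forall i, y i = X i \/
        exists2 k, y i = Y k & Pos i (out delta) k \in prem r.

Definition delta2 : Prop :=
  forall (m : nat) (r : 'I_m -> rule G n) (l : 'I_m -> formula n),
    injective r ->
    (forall r', output_rule r' <-> exists j, r' = r j) ->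
    (forall j, exists2 h, h \in prem (r j) & negates (l j) h) ->
    let H := [fset l j | j in 'I_m] in
    (forall H1 H2 : {fset formula n}, H1 `<=` H -> H2 `<=` H ->
       ~ contradict_each_other delta H1 H2) ->
    let r0 := Rule H (out delta) (Op [ffun i => Var G (X i)]) in
    gsos_rule r0 -> includes_rule r0.

Definition quiescent_consistent : Prop := delta1 /\ delta2.

End QuiescentConsistent.
End Language.
End Actions.

Arguments out {I O}.

(* Main.v *)
(* Both directions rest on two facts about a vector p of states: an f-rule can
   be applied to p as soon as all its premises hold there, and two sets of
   premises that hold at p are never contradictory, because the states of p
   satisfy the quiescence axiom.  By the second fact a delta-rule and an
   output rule cannot both fire, which with [delta1] gives one direction.
   Conversely, if f(p) has no proper output, every output rule has a premise
   that fails at p; the negations of these premises hold at p, hence do not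
   contradict each other, and so [delta2] makes them the premises of a
   delta-rule, which fires. *)
Require Import Defs.
From mathcomp Require Import all_boot finmap boolp.
From Stdlib Require List.

Set Implicit Arguments.
Unset Strict Implicit.
Unset Printing Implicit Defensive.

Local Open Scope fset_scope.

(** [delta2] asks for the output rules to be enumerated without repetition, while a language only
    supplies a list covering its rules. Classical logic decides [P] and equality, so the list can be
    filtered and stripped of duplicates. *)
Lemma injective_enumeration (T : Type) (P : T -> Prop) (s : seq T) :
  (forall x, P x -> List.In x s) ->
  exists m (r : 'I_m -> T), injective r /\ forall x, P x <-> exists j, x = r j.
Proof.
move=> Ps; pose s' := undup ([seq x <- s | `[< P x >]] : seq {classic T}).
exists (size s'), (tnth (in_tuple s')); split.
  exact/(@tuple_uniqP (size s') {classic T} (in_tuple s'))/undup_uniq.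
have memP (x : {classic T}) (t : seq {classic T}) : List.In x t -> x \in t.
  elim: t => //= y t IHt [->|/IHt]; rewrite inE ?eqxx // => ->.
  by rewrite orbT.
move=> x; split=> [Px|[j ->]].
  apply/(@tnthP (size s') {classic T} (in_tuple s')); rewrite mem_undup mem_filter.
  by apply/andP; split; [apply/asboolP | apply/memP/Ps].
have := mem_tnth j (in_tuple s').
by rewrite mem_undup mem_filter => /andP[/asboolP].
Qed.

Section Satisfaction.
Variables (I O : finType) (M : lts I O).

(** The variable of a positive premise is ignored, so truth at [p] is invariant under renaming the
    y_k. *)
Definition holds (n : nat) (p : 'I_n -> M) (h : formula I O n) : Prop :=
  match h with
  | Pos i a _ => enabled (p i) a
  | Neg i a => ~ enabled (p i) a
  end.

Lemma holds_not_contradict (delta : O) n (p : 'I_n -> M)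
    (H H' : {fset formula I O n}) :
  lts_io delta M -> {in H, forall h, holds p h} ->
  {in H', forall h, holds p h} -> ~ contradict delta H H'.
Proof.
move=> hM pH pH' HH'; case: HH' pH pH' => {H H'}
  [i a k|i b k k' bN|i H H' _ _ HH'] pH pH'.
- exact: (pH' (Neg i a) (fset11 _)) (pH (Pos i a k) (fset11 _)).
- have [q /hM[_ /(_ b bN)]] := pH' (Pos i (out delta) k') (fset11 _).
  by apply; apply: (pH (Pos i (out b) k) (fset11 _)).
- have quiet b : ~ enabled (p i) (out b).
    have : Neg i (out b) \in H `|` H' by rewrite HH'; apply: in_imfset.
    by rewrite inE => /orP[/pH|/pH'].
  (* Refusing every output other than [delta] makes [p i] quiescent, so the axiom gives it a
     [delta]-loop, which [quiet] excludes. *)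
  by apply: (quiet delta); exists (p i); apply/hM; split.
Qed.

Lemma holds_not_contradict_each_other (delta : O) n (p : 'I_n -> M)
    (H H' : {fset formula I O n}) :
  lts_io delta M -> {in H, forall h, holds p h} ->
  {in H', forall h, holds p h} -> ~ contradict_each_other delta H H'.
Proof.
by move=> hM pH pH' []; [apply: holds_not_contradict hM pH pH' |
  apply: holds_not_contradict hM pH' pH].
Qed.

Lemma holds_not_contradictory (delta : O) n (p : 'I_n -> M)
    (H H' : {fset formula I O n}) :
  lts_io delta M -> {in H, forall h, holds p h} ->
  {in H', forall h, holds p h} -> ~ contradictory delta H H'.
Proof.
move=> hM pH pH' [H1 [H2 [/fsubsetP sH1 /fsubsetP sH2]]].
by apply: (holds_not_contradict_each_other (p := p) hM) => h;
  [move/sH1; apply: pH | move/sH2; apply: pH'].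
Qed.

(* The witness is named Y k so that premises obtained from distinct k have
   distinct variables. *)
Lemma negates_holds n (p : 'I_n -> M) (h : formula I O n) (k : nat) :
  ~ holds p h ->
  exists l, [/\ negates l h, holds p l & forall i a k', l = Pos i a k' -> k' = k].
Proof.
case: h => [i a k'|i a] /= hN; first by exists (Neg i a).
by exists (Pos i a k); split=> // [|i' a' k' []]; first exact: contrapT hN.
Qed.

End Satisfaction.

Section Firing.
Variables (I O : finType) (G : gsos_language I O) (f : G) (M : lts I O).
Variable p : {ffun 'I_(arity f) -> M}.
Let fp : gsos_lts G M := Op [ffun i => Var G (p i)].

Lemma enabled_Op a :
  enabled fp a <-> exists r : rule I O G (arity f),
    [/\ rules r, label r = a & {in prem r, forall h, holds p h}].
Proof.
split=> [[t' [r [q [[rr ra] hP hN _]]]]|[r [rr ra pr]]].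
  exists r; split=> // -[i b k /hP|i b /hN]; rewrite ffunE /=.
    by case=> u pu _; exists u.
  by move=> pN [u pu]; apply: pN; exists (Var G u), u.
(* Each y_k is the target of at most one premise, so witnesses can be chosen separately for each
   [k]; [fp] is a dummy value for the y_k in no premise. *)
have /choice[q hq] k : exists u : term G M, forall i b,
    Pos i b k \in prem r -> step (Var G (p i)) b u.
  have [[i [b hk]]|hk] := pselect (exists i b, Pos i b k \in prem r).
    have [u pu] := pr _ hk; exists (Var G u) => i' b' hk'.
    have [ii' bb'] := (rules_gsos rr).1 _ _ _ _ _ hk hk'.
    by exists u; rewrite -?ii' -?bb'.
  by exists fp => i b hk'; case: hk; exists i, b.
eexists; exists r, q; split=> // i b => [k hk|hk]; rewrite ffunE; first exact: hq.
by case=> _ [u pu _]; apply: (pr _ hk); exists u.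
Qed.

(** Each argument of the rule's target is x_i or a [delta]-successor of x_i, and a [delta]-step of a
    state of [M] leads back to that state. *)
Lemma delta_step_eq (delta : O) (p' : term G M) :
  delta1 delta f -> lts_io delta M -> trans fp (out delta) p' -> p' = fp.
Proof.
move=> d1 hM [r [q [[rr rd] hP _ ->]]].
have [_ [y -> hy]] := d1 r rr rd.
congr Op; apply/ffunP=> i; rewrite !ffunE /=.
have [->|[k -> /hP]] := hy i; first by rewrite ffunE.
by rewrite ffunE => -[u /hM[<- _] ->].
Qed.

Lemma delta_no_output (delta : O) (b : O) :
  delta1 delta f -> lts_io delta M -> b != delta ->
  enabled fp (out delta) -> ~ enabled fp (out b).
Proof.
move=> d1 hM bN /enabled_Op[r [rr rd pr]] /enabled_Op[r' [rr' rb pr']].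
have [/(_ r') rr'N _] := d1 r rr rd.
apply: (holds_not_contradictory hM pr pr').
by apply: rr'N; split=> //; exists b.
Qed.

Lemma no_output_delta (delta : O) :
  delta2 delta f -> lts_io delta M ->
  (forall b, b != delta -> ~ enabled fp (out b)) -> enabled fp (out delta).
Proof.
move=> d2 hM noout.
have [s hs] := rules_finite f.
have [|m [r [r_inj hr]]] := @injective_enumeration _ (output_rule delta (f := f)) s.
  by move=> r [rr _]; apply: hs.
have /choice[l hl] (j : 'I_m) : exists l, [/\ exists2 h, h \in prem (r j) & negates l h,
    holds p l & forall i a k, l = Pos i a k -> k = j].
  have [rr [b bN rb]] : output_rule delta (r j) by apply/hr; exists j.
  have [h hj hN] : exists2 h, h \in prem (r j) & ~ holds p h.
    apply: contrapT => pr; apply: (noout b bN); apply/enabled_Op.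
    exists (r j); split=> // h hj; apply: contrapT => hN.
    by apply: pr; exists h.
  by have [l [lh pl lk]] := negates_holds j hN; exists l; split=> //; exists h.
pose H := [fset l j | j in 'I_m].
have pH : {in H, forall h, holds p h}.
  by move=> _ /imfsetP[j _ ->]; have [] := hl j.
have [||H1 H2 /fsubsetP sH1 /fsubsetP sH2||rho _ rr] := d2 m r l r_inj.
- exact: hr.
- by move=> j; have [] := hl j.
- by apply: (holds_not_contradict_each_other (p := p) hM) => h;
    [move/sH1; apply: pH | move/sH2; apply: pH].
(* A positive [l j] binds only y_j, so premises sharing a variable coincide. *)
- split=> [i i' a a' k /imfsetP[j _ lj] /imfsetP[j' _ lj']|k [i]] /=.
    have [_ _ /(_ _ _ _ (esym lj)) kj] := hl j.
    have [_ _ /(_ _ _ _ (esym lj')) kj'] := hl j'.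
    have jj' : j = j' by apply: val_inj; rewrite /= -kj.
    by move: lj'; rewrite -jj' -lj => -[-> ->].
  by rewrite ffunE.
apply/enabled_Op; eexists; split; [exact: rr | by [] |].
(* The language has this rule only up to renaming, which [holds] does not see. *)
by move=> _ /imfsetP[h /pH ph ->]; case: h ph.
Qed.

End Firing.

Theorem theorem7 (I O : finType) (delta : O) (G : gsos_language I O) (f : G)
    (hf : quiescent_consistent delta f)
    (M : lts I O) (hM : lts_io delta M)
    (p : {ffun 'I_(arity f) -> M}) (p' : gsos_lts G M) :
  let fp : gsos_lts G M := Op [ffun i => Var G (p i)] in
  trans fp (out delta) p' <->
  p' = fp /\ forall a : O, a != delta -> ~ enabled fp (out a).
Proof.
case: hf => d1 d2 fp; split=> [pp'|[-> noout]].
  split=> [|a aN]; first exact: delta_step_eq pp'.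
  by apply: delta_no_output aN _ => //; exists p'.
have [t pt] := no_output_delta d2 hM noout.
(* The target [t] of the [delta]-step found is not specified, but [delta1] forces it to be [fp]. *)
by rewrite -[X in trans _ _ X](delta_step_eq d1 hM pt).
Qed.
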